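(* Let $V$ be a real inner product space (of arbitrary, possibly infinite, dimension) with complexification $V_{\mathbb{C}}$, and let $W \leqslant V_{\mathbb{C}}$ be any complex subspace. Then the supercommutant of $C(W)$ in $C(V_{\mathbb{C}})$ is given by \[ C(W)' = C(W^{\perp}). \]
   Context: $V$ is a real vector space with a positive-definite inner product $(\cdot|\cdot)$; no assumption is made on its dimension or completeness. The inner product is extended to a nonsingular symmetric complex-bilinear form, also denoted $(\cdot|\cdot)$, on the complexification $V_{\mathbb{C}}$. For a complex subspace $W \leqslant V_{\mathbb{C}}$, \[ W^{\perp} = \{ z \in V_{\mathbb{C}} : (w|z) = 0 \text{ for all } w \in W \} \] is the orthogonal space with respect to the complex-bilinear form (so $W \cap W^\perp$ need not be zero). The Clifford algebra $C(V_{\mathbb{C}})$ is the unital associative complex algebra with a linear embedding $V_{\mathbb{C}} \subseteq C(V_{\mathbb{C}})$, universal subject to the Clifford relation $vv = (v|v)\mathbf{1}$ for all $v \in V_{\mathbb{C}}$. For a subspace $W \leqslant V_{\mathbb{C}}$, $C(W)$ is the Clifford algebra of $W$ with the restricted form, identified with the unital subalgebra of $C(V_{\mathbb{C}})$ generated by $W$. The grading automorphism $\gamma$ of $C(V_{\mathbb{C}})$ is the unique algebra automorphism with $\gamma(v) = -v$ for $v \in V_{\mathbb{C}}$; $C(V_{\mathbb{C}})_+ = \{a : \gamma(a) = a\}$ and $C(V_{\mathbb{C}})_- = \{a : \gamma(a) = -a\}$ are the even and odd parts. The supercommutant of $C(W)$ in $C(V_{\mathbb{C}})$ is $C(W)'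 = C(W)'_+ \oplus C(W)'_-$, where \[ C(W)'_+ = \{ a \in C(V_{\mathbb{C}})_+ : ba = ab \text{ for all } b \in C(W) \}, \] \[ C(W)'_- = \{ a \in C(V_{\mathbb{C}})_- : ba = a\gamma(b) \text{ for all } b \in C(W) \}. \] *)

(* Defs.v *)
From HB Require Import structures.
From mathcomp Require Import all_boot all_order all_algebra.
From mathcomp Require Import complex ring.
From mathcomp Require Import boolp classical_sets reals.

Set Implicit Arguments.
Unset Strict Implicit.
Unset Printing Implicit Defensive.

Import Order.Theory GRing.Theory Num.Theory.

Local Open Scope ring_scope.
Local Open Scope complex_scope.
Local Open Scope classical_set_scope.

(* The pair [(x, y)] stands for [x + i y]. *)
Definition complexification (R : realType) (V : lmodType R) : Type :=
  (V * V)%type.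

Section Complexification.
Variables (R : realType) (V : lmodType R).
Local Notation VC := (complexification V).

HB.instance Definition _ := GRing.Zmodule.copy VC (V * V)%type.

Definition cscale (c : R[i]) (z : VC) : VC :=
  (complex.Re c *: z.1 - complex.Im c *: z.2,
   complex.Re c *: z.2 + complex.Im c *: z.1).

Fact cscaleA a b z : cscale a (cscale b z) = cscale (a * b) z.
Proof.
case: a b z => [a a'] [b b'] [x y]; congr pair => /=.
- rewrite !scalerBr !scalerDr !scalerA scalerBl scalerDl !opprD.
  by rewrite (AC (2*2) ((1*4)*(2*3))).
- rewrite !scalerBr !scalerDr !scalerA scalerBl scalerDl.
  by rewrite (AC (2*2) ((1*4)*(2*3))).
Qed.

Fact cscale1 : left_id 1 cscale.
Proof.
by case=> x y; congr pair; rewrite /= scale1r scale0r ?subr0 ?addr0.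
Qed.

Fact cscaleDr : right_distributive cscale +%R.
Proof.
case=> [a b] [x y] [x' y']; congr pair; rewrite /= !scalerDr ?opprD;
  exact: addrACA.
Qed.

Fact cscaleDl z : {morph cscale^~ z : a b / a + b}.
Proof.
case: z => x y [a a'] [b b']; congr pair; rewrite /= !scalerDl ?opprD;
  exact: addrACA.
Qed.

HB.instance Definition _ :=
  GRing.Zmodule_isLmodule.Build R[i] VC cscaleA cscale1 cscaleDr cscaleDl.

Variable ip : {dot V for idfun}.

(* The complex-bilinear (not sesquilinear) extension of [ip]. *)
Definition cform (z w : VC) : R[i] :=
  (ip z.1 w.1 - ip z.2 w.2) +i* (ip z.1 w.2 + ip z.2 w.1).

Fact cform_sym z w : cform z w = (-1) ^+ false * idfun (cform w z).
Proof.
have ipC x y : ip x y = ip y x.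
  by rewrite [LHS]hermitian_subproof expr0 mul1r.
rewrite expr0 mul1r /cform (ipC z.1) (ipC z.2) (ipC z.1) (ipC z.2).
by congr (_ +i* _); rewrite addrC.
Qed.

Fact cform_linearr z : linear_for *%R (cform z : VC -> R[i]).
Proof.
have ipZ u c x : ip u (c *: x) = c * ip u x by exact: linearZr_LR.
case: z => u v [a b] [x y] [x' y'].
rewrite /cform /= !(linearD, linearN) /= !ipZ.
by apply/eqP; rewrite eq_complex /=; apply/andP; split; apply/eqP; ring.
Qed.

Fact cform_linearl w : linear_for *%R (cform^~ w : VC -> R[i]).
Proof.
move=> c x y; rewrite !(cform_sym _ w) !expr0 !mul1r; exact: cform_linearr.
Qed.

HB.instance Definition _ := bilinear_isBilinear.Build R[i] VC VC R[i]
  *%R (idfun \; *%R) cform (cform_linearl, cform_linearr).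

HB.instance Definition _ :=
  isHermitianSesquilinear.Build R[i] VC false idfun cform cform_sym.

Lemma cform_nonsingular z : (forall w, cform z w = 0) -> z = 0.
Proof.
case: z => x y /(_ (x, - y)) [/= xy0 _].
have ip_ge0 u : 0 <= ip u u.
  have [->|/neq0_dnorm_gt0/ltW//] := eqVneq u 0.
  by rewrite linear0r.
have ip_eq0 u : ip u u = 0 -> u = 0.
  by apply: contra_eq => /neq0_dnorm_gt0/lt0r_neq0.
have {}xy0 : ip x x + ip y y = 0 by rewrite -[ip y y]opprK -linearN.
move/eqP: xy0; rewrite paddr_eq0// => /andP[/eqP/ip_eq0-> /eqP/ip_eq0->].
by [].
Qed.

(* The orthogonal for the bilinear form: it may meet [W] nontrivially. *)
Definition orthogonal_space (W : set VC) : set VC :=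
  [set z | forall w, W w -> cform w z = 0].

End Complexification.

Section CliffordAlgebra.
Variables (K : fieldType) (U : lmodType K) (q : {symmetric U}).

Record is_clifford (A : algType K) (iota : {linear U -> A}) : Prop := {
  clifford_inj : injective iota;
  clifford_rel : forall v, iota v * iota v = (q v v)%:A;
  clifford_univ : forall (B : algType K) (f : {linear U -> B}),
    (forall v, f v * f v = (q v v)%:A) ->
    exists2 g : {lrmorphism A -> B}, (forall v, g (iota v) = f v) &
      forall h : {lrmorphism A -> B}, (forall v, h (iota v) = f v) -> h =1 g
}.

Variables (A : algType K) (iota : {linear U -> A}).

(* [C(W)], identified with the unital subalgebra generated by [W]. *)
Definition clifford_subalg (W : set U) : set A :=
  smallest (fun S : set A => GRing.subalg_closed (mem S)) (iota @` W).

Hypothesis cliffA : is_clifford iota.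

Fact clifford_opp_subproof v : (- iota v) * (- iota v) = (q v v)%:A.
Proof. by rewrite mulrNN (clifford_rel cliffA). Qed.

Lemma grading_exists :
  exists g : {lrmorphism A -> A}, forall v, g (iota v) = - iota v.
Proof.
have [g gE _] := clifford_univ cliffA (f := -%R \o iota) clifford_opp_subproof.
by exists g.
Qed.

Definition grading : {lrmorphism A -> A} := sval (cid grading_exists).

Lemma gradingE v : grading (iota v) = - iota v.
Proof. exact: (svalP (cid grading_exists)). Qed.

Lemma gradingK : involutive grading.
Proof.
have [g _ gU] := clifford_univ cliffA (clifford_rel cliffA).
move=> a; rewrite -[RHS]/(idfun a) [RHS]gU//.
rewrite -[LHS]/((grading \o grading) a) [LHS]gU//= => v.
by rewrite gradingE rmorphN /= gradingE opprK.
Qed.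

Lemma grading_unique (g : {lrmorphism A -> A}) :
  (forall v, g (iota v) = - iota v) -> g =1 grading.
Proof.
have [h _ hU] := clifford_univ cliffA (f := -%R \o iota) clifford_opp_subproof.
by move=> gE a; rewrite hU// [RHS]hU//; exact: gradingE.
Qed.

Definition even_part : set A := [set a | grading a = a].
Definition odd_part : set A := [set a | grading a = - a].

Definition supercommutant_even (B : set A) : set A :=
  [set a | even_part a /\ forall b, B b -> b * a = a * b].
Definition supercommutant_odd (B : set A) : set A :=
  [set a | odd_part a /\ forall b, B b -> b * a = a * grading b].
Definition supercommutant (B : set A) : set A :=
  [set x + y | x in supercommutant_even B & y in supercommutant_odd B].

End CliffordAlgebra.

(* Main.v *)
Require Import Defs.
From HB Require Import structures.
From mathcomp Require Import all_boot all_order all_algebra.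
From mathcomp Require Import complex.
From mathcomp Require Import boolp classical_sets reals.
Import GRing.Theory Num.Theory.
Local Open Scope ring_scope.
Local Open Scope complex_scope.
Local Open Scope classical_set_scope.

(** Write [a |-> grading a] as g. An element [a] supercommutes with [C(W)] if
    and only if [w a = g(a) w] for every [w] in [W], that is, if and only if the
    antiderivation [a |-> w a - g(a) w], which sends a vector [v] to [2 (w|v)],
    kills [a] for every [w] in [W]. So the theorem says that the common kernel
    of these antiderivations is [C(W^perp)].

    Elements of [C(W^perp)] are killed because [w] anticommutes with the
    generators ([clifford_twisted_commute]); averaging [a] with [g(a)] then
    gives the even and odd parts required by the supercommutant.

    Conversely, [a] lies in the subalgebra generated by [W^perp] and finitely
    many further vectors ([clifford_finitely_generated]), and these vectors can
    be removed one at a time. If one of them, [f], is not in [W^perp], pick [w]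
    in [W] with [(w|f) <> 0] and subtract multiples of [f] from the others to
    make them orthogonal to [w]. Now [a = b + f c], where [b] and [c] are in
    the subalgebra generated by the vectors other than [f]
    ([clifford_adjoin]), and the antiderivation of [w] sends [a] to
    [2 (w|f) c]. So [c = 0], and [a = b] is generated without [f]
    ([clifford_drop]).

    Each [a] involves only finitely many vectors, which is how infinite
    dimension is handled. The lemmas are stated for a symmetric bilinear form
    over a field, of characteristic other than 2 where [2 (w|f) c = 0] is
    solved for [c] or [a] is split into its even and odd parts. *)

Section Subalgebra.
Set Implicit Arguments.
Unset Strict Implicit.
Context {K : fieldType} {U : lmodType K} {A : algType K}.
Implicit Types (S : set A) (iota : {linear U -> A}) (X Y : set U).

Lemma subalg_closed_setP S :
  GRing.subalg_closed (mem S) <->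
  [/\ S 1, forall k a b, S a -> S b -> S (k *: a + b)
    & forall a b, S a -> S b -> S (a * b)].
Proof.
split=> -[S1 Slin SM]; split.
- exact: set_mem.
- by move=> k a b Sa Sb; apply/set_mem/Slin; apply/mem_set.
- by move=> a b Sa Sb; apply/set_mem/SM; apply/mem_set.
- exact/mem_set.
- by move=> k a b /set_mem Sa /set_mem Sb; apply/mem_set/Slin.
- by move=> a b /set_mem Sa /set_mem Sb; apply/mem_set/SM.
Qed.

Lemma clifford_subalg_closed iota X :
  GRing.subalg_closed (mem (clifford_subalg iota X)).
Proof.
apply/subalg_closed_setP; split.
- by move=> S [/subalg_closed_setP[]].
- move=> k a b Xa Xb S XS; have [/subalg_closed_setP[_ Slin _] _] := XS.
  by apply: Slin; [exact: Xa | exact: Xb].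
- move=> a b Xa Xb S XS; have [/subalg_closed_setP[_ _ SM] _] := XS.
  by apply: SM; [exact: Xa | exact: Xb].
Qed.

Lemma clifford_subalg_gen iota X v : X v -> clifford_subalg iota X (iota v).
Proof. by move=> Xv S [_]; apply; exists v. Qed.

Lemma clifford_subalg_sub iota X S :
  GRing.subalg_closed (mem S) -> (forall v, X v -> S (iota v)) ->
  clifford_subalg iota X `<=` S.
Proof. by move=> Sc XS; apply: smallest_sub => // _ [v Xv <-]; exact: XS. Qed.

Lemma clifford_subalg_le iota X Y :
  (forall v, X v -> clifford_subalg iota Y (iota v)) ->
  clifford_subalg iota X `<=` clifford_subalg iota Y.
Proof.
by move=> XY; apply: clifford_subalg_sub => //; exact: clifford_subalg_closed.
Qed.

Lemma clifford_subalgS iota X Y :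
  X `<=` Y -> clifford_subalg iota X `<=` clifford_subalg iota Y.
Proof.
by move=> XY; apply: clifford_subalg_le => v /XY; exact: clifford_subalg_gen.
Qed.

End Subalgebra.

Section Clifford.
Set Implicit Arguments.
Unset Strict Implicit.
Context {K : fieldType} {U : lmodType K} {q : {symmetric U}}
  {A : algType K} {iota : {linear U -> A}} (cliffA : is_clifford q iota).
Local Notation C := (clifford_subalg iota).
Implicit Types (v w f : U) (X Y W : set U) (a b c : A).

(** Universality lifts [iota] to a morphism from [A] to the subalgebra [S].
    Followed by the inclusion of [S], it fixes the vectors, so by uniqueness
    it is the identity of [A], and every element of [A] is in [S]. *)
Lemma clifford_generated (S : {pred A}) :
  GRing.subalg_closed S -> (forall v, iota v \in S) -> forall a, a \in S.
Proof.
move=> Sclosed Siota a.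
(* The subalgebra is made an abstract structure, to keep terms small. *)
suff: forall B : subAlgType S, a \in S.
  by apply; exact (HB.pack {x : A | x \in S}
    (GRing.SubChoice_isSubAlgebra.Build K A S {x : A | x \in S}
       (GRing.subalg_closed_semi Sclosed))).
move=> B.
pose f0 v : B := Sub (iota v) (Siota v).
have f0_lin : linear f0.
  by move=> k x y; apply: val_inj; rewrite linearP /= !SubK linearP.
pose f : {linear U -> B} :=
  HB.pack f0 (GRing.isLinear.Build K U B _ f0 f0_lin).
have frel v : f v * f v = (q v v)%:A.
  apply: val_inj; rewrite rmorphM linearZ rmorph1 /= !SubK.
  exact: (clifford_rel cliffA).
have [g gf _] := clifford_univ cliffA frel.
have [h _ hU] := clifford_univ cliffA (clifford_rel cliffA).
have -> : a = val (g a).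
  transitivity (h a); first by rewrite -[LHS]/(idfun a) hU.
  have vg_lin : linear (val \o g) by move=> k x y; rewrite /= !linearP.
  have vg_mul : GRing.monoid_morphism (val \o g).
    by split=> [|x y]; rewrite /= ?rmorph1 ?rmorphM.
  pose vg : {lrmorphism A -> A} := HB.pack (val \o g)
    (GRing.isLinear.Build K A A _ _ vg_lin)
    (GRing.isMonoidMorphism.Build A A _ vg_mul).
  by rewrite -[RHS]/(vg a) [RHS]hU // => v; rewrite /= gf /= SubK.
exact: valP.
Qed.

Lemma clifford_finitely_generated a : exists s : seq U, C [set` s] a.
Proof.
pose S := [set a | exists s : seq U, C [set` s] a].
suff: a \in mem S by move/set_mem.
have catl s t : C [set` s] `<=` C [set` (s ++ t)].
  by apply: clifford_subalgS => v; rewrite /= mem_cat => ->.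
have catr s t : C [set` t] `<=` C [set` (s ++ t)].
  by apply: clifford_subalgS => v; rewrite /= mem_cat => ->; rewrite orbT.
have closed s := iffLR (subalg_closed_setP _) (clifford_subalg_closed iota s).
apply: clifford_generated; last first.
  move=> v; apply/mem_set; exists [:: v]; apply: clifford_subalg_gen.
  exact: mem_head.
apply/subalg_closed_setP; split.
- by exists [::]; case: (closed [set` [::]]).
- move=> k x y [s sx] [t ty]; exists (s ++ t).
  have [_ lin _] := closed [set` (s ++ t)].
  by apply: lin; [apply: catl | apply: catr].
- move=> x y [s sx] [t ty]; exists (s ++ t).
  have [_ _ mul] := closed [set` (s ++ t)].
  by apply: mul; [apply: catl | apply: catr].
Qed.

Lemma clifford_anticomm v w :
  iota v * iota w = (2%:R * q v w)%:A - iota w * iota v.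
Proof.
have qC : q w v = q v w by rewrite hermC expr0 mul1r.
have := clifford_rel cliffA (v + w).
rewrite linearD mulrDl !mulrDr !(clifford_rel cliffA) linearDl !linearDr /= qC.
rewrite !scalerDl mulr_natl mulr2n scalerDl => /eqP.
rewrite -!addrA (inj_eq (addrI _)) !addrA (inj_eq (addIr _)) => /eqP <-.
by rewrite addrK.
Qed.

(** Moving [f] to the left past the other generators, and using that [f f] is
    a scalar, leaves at most one factor [f]. In the proof, the set of elements
    [b + f c] contains 1 and is stable under left multiplication by [f] and by
    [Y], so it contains the whole subalgebra. *)
Lemma clifford_adjoin f Y a : C (f |` Y) a ->
  exists b c, [/\ C Y b, C Y c & a = b + iota f * c].
Proof.
have [C1 Clin CM] :=
  iffLR (subalg_closed_setP _) (clifford_subalg_closed iota Y).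
have C0 : C Y 0 by rewrite -(subrr 1) -scaleN1r addrC; exact: Clin.
pose M := [set a | exists b c, [/\ C Y b, C Y c & a = b + iota f * c]].
have Mlin k x y : M x -> M y -> M (k *: x + y).
  move=> [b [c [Yb Yc ->]]] [b' [c' [Yb' Yc' ->]]].
  exists (k *: b + b'), (k *: c + c'); split; try exact: Clin.
  by rewrite scalerDr mulrDr scalerAr addrACA.
suff MC : C (f |` Y) `<=` [set x | forall m, M m -> M (x * m)].
  by move=> /MC /(_ 1); rewrite mulr1; apply; exists 1, 0; rewrite mulr0 addr0.
apply: clifford_subalg_sub.
  apply/subalg_closed_setP; split => [m|k x y xM yM m Mm|x y xM yM m Mm].
  - by rewrite mul1r.
  - by rewrite mulrDl -scalerAl; apply: Mlin; [exact: xM | exact: yM].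
  - by rewrite -mulrA; apply/xM/yM.
move=> v [->|Yv] _ [b [c [Yb Yc ->]]].
  exists (q f f *: c + 0), b; split=> //; first exact: Clin.
  by rewrite addr0 mulrDr mulrA (clifford_rel cliffA) -scalerAl mul1r addrC.
have Cv : C Y (iota v) by exact: clifford_subalg_gen.
exists ((2%:R * q v f) *: c + iota v * b), ((-1) *: (iota v * c) + 0).
split; [by apply: Clin => //; apply: CM | by apply: Clin => //; apply: CM |].
rewrite addr0 scaleN1r mulrN mulrDr !mulrA clifford_anticomm mulrBl -scalerAl.
by rewrite mul1r addrCA addrA.
Qed.

(** Both sides are multiplicative in [a], up to moving [w] across, so it is
    enough that [w] anticommutes with each generator. *)
Lemma clifford_twisted_commute Y w a : (forall y, Y y -> q w y = 0) -> C Y a ->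
  iota w * a = grading cliffA a * iota w.
Proof.
move=> wY; move: a; apply: clifford_subalg_sub => [|y /wY wy].
  apply/subalg_closed_setP; split => [|k x y /= wx wy|x y /= wx wy].
  - by rewrite /= rmorph1 mulr1 mul1r.
  - by rewrite linearP mulrDr mulrDl -scalerAl -scalerAr wx wy.
  - by rewrite rmorphM mulrA wx -mulrA wy mulrA.
by rewrite /= gradingE clifford_anticomm wy mulr0 scale0r sub0r mulNr.
Qed.

(** Lets the even supercommutant be tested on generators only. *)
Lemma clifford_commute X a :
  (forall v, X v -> iota v * a = a * iota v) ->
  forall b, C X b -> b * a = a * b.
Proof.
apply: clifford_subalg_sub; apply/subalg_closed_setP.
split=> [|k b c /= ba ca|b c /= ba ca].
- by rewrite /= mul1r mulr1.
- by rewrite mulrDl mulrDr -scalerAl -scalerAr ba ca.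
- by rewrite -mulrA ca mulrA ba mulrA.
Qed.

(** Lets the odd supercommutant be tested on generators only. *)
Lemma clifford_anticommute X a :
  (forall v, X v -> iota v * a = - (a * iota v)) ->
  forall b, C X b -> b * a = a * grading cliffA b.
Proof.
move=> Xa; apply: clifford_subalg_sub => [|v Xv]; last first.
  by rewrite /= gradingE mulrN Xa.
apply/subalg_closed_setP; split=> [|k b c /= ba ca|b c /= ba ca].
- by rewrite /= rmorph1 mul1r mulr1.
- by rewrite linearP mulrDl mulrDr -scalerAl -scalerAr ba ca.
- by rewrite rmorphM -mulrA ca mulrA ba mulrA.
Qed.

Hypothesis two_neq0 : 2%:R != 0 :> K.

(** With [a = b + f c] as in [clifford_adjoin], moving [w] through [b], [f] and
    [c] gives [w a = g(a) w + 2 (w|f) c], where g is the grading; so the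
    hypothesis on [a] forces [c = 0]. *)
Lemma clifford_drop f Y w a : (forall y, Y y -> q w y = 0) -> q w f != 0 ->
  C (f |` Y) a -> iota w * a = grading cliffA a * iota w -> C Y a.
Proof.
move=> wY wf /clifford_adjoin[b [c [Yb Yc ->]]].
rewrite rmorphD rmorphM /= gradingE mulrDr mulrDl mulrA clifford_anticomm.
rewrite (clifford_twisted_commute wY Yb) mulrBl.
rewrite -[_ * _ * c]mulrA (clifford_twisted_commute wY Yc).
rewrite !mulNr mulrA => /addrI /(canRL (subrK _)); rewrite addNr => /eqP.
rewrite -scalerAl mul1r scaler_eq0 mulf_eq0 (negPf two_neq0) (negPf wf) /=.
by move/eqP ->; rewrite mulr0 addr0.
Qed.

(** The common kernel of the antiderivations of the vectors of [W], by
    induction on the number of vectors outside the orthogonal of [W] that are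
    used to generate [a]. *)
Lemma clifford_orthogonal W a :
  (forall w, W w -> iota w * a = grading cliffA a * iota w) ->
  C [set v | forall w, W w -> q w v = 0] a.
Proof.
set X := [set v | _] => Wa.
have [s sa] := clifford_finitely_generated a.
have {sa} : C (X `|` [set` s]) a by apply: clifford_subalgS sa; exact: subsetUr.
elim: {s}(size s) {-2}s (erefl (size s)) => [|n IHn] [|f s] //=.
  by move=> _; apply: clifford_subalgS => v [].
move=> [sz].
have [Xf|] := pselect (X f).
  move=> sa; apply: (IHn s sz).
  apply: clifford_subalgS sa => v [Xv|]; first by left.
  by rewrite /= inE => /predU1P[->|]; [left | right].
move=> /existsNP[w /not_implyP[Ww /eqP wf]] sa.
(* The projection along [f] onto the orthogonal of [w]. *)
pose g v := v - (q w v / q w f) *: f.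
pose s' := map g s.
have szs' : size s' = n by rewrite size_map.
apply: (IHn s' szs').
apply: (clifford_drop (f := f) (w := w)) (Wa _ Ww) => //.
  move=> y [/(_ _ Ww)//|/= /mapP[v _ ->]].
  by rewrite /g linearBr linearZr_LR /= divfK // subrr.
apply: clifford_subalg_le sa => v sv.
have Cgen u : (f |` (X `|` [set` s'])) u -> C (f |` (X `|` [set` s'])) (iota u).
  exact: clifford_subalg_gen.
case: sv => [Xv|]; first by apply: Cgen; right; left.
rewrite /= inE => /predU1P[->|sv]; first by apply: Cgen; left.
have [_ Clin _] := iffLR (subalg_closed_setP _)
  (clifford_subalg_closed iota (f |` (X `|` [set` s']))).
rewrite -(subrK ((q w v / q w f) *: f) v) addrC linearD linearZ.
apply: Clin; apply: Cgen; [by left | right; right].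
exact: map_f.
Qed.

Theorem supercommutant_clifford W :
  supercommutant cliffA (C W) = C [set v | forall w, W w -> q w v = 0].
Proof.
apply/seteqP; split.
  move=> _ [x [x_even xW] [y [y_odd yW] <-]].
  apply: clifford_orthogonal => w Ww.
  have Cw : C W (iota w) by exact: clifford_subalg_gen.
  rewrite mulrDr rmorphD mulrDl /= x_even y_odd (xW _ Cw) (yW _ Cw) gradingE.
  by rewrite mulrN mulNr.
move=> a Wa.
pose x := 2%:R^-1 *: (a + grading cliffA a).
pose y := 2%:R^-1 *: (a - grading cliffA a).
have comm w : W w -> iota w * a = grading cliffA a * iota w.
  by move=> Ww; apply: clifford_twisted_commute Wa => v; apply.
(* The grading turns the relation for [a] into the relation for its image. *)
have commg w : W w -> iota w * grading cliffA a = a * iota w.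
  move=> Ww; apply: (can_inj (gradingK cliffA)).
  rewrite !rmorphM /= gradingK gradingE mulNr mulrN.
  by rewrite comm.
exists x.
  split; first by rewrite /even_part /= linearZ linearD /= gradingK addrC.
  apply: clifford_commute => w Ww; rewrite /x -scalerAr -scalerAl mulrDr mulrDl.
  by rewrite comm // commg // addrC.
exists y.
  split.
    by rewrite /odd_part /= linearZ linearB /= gradingK -scalerN opprB.
  apply: clifford_anticommute => w Ww.
  rewrite /y -scalerAr -scalerAl mulrBr mulrBl.
  by rewrite comm // commg // -scalerN opprB.
rewrite -scalerDr addrACA subrr addr0 -mulr2n -scaler_nat scalerA mulVf //.
by rewrite scale1r.
Qed.

End Clifford.

Theorem theorem0p1 (R : realType) (V : lmodType R) (ip : {dot V for idfun})
    (A : algType R[i]) (iota : {linear complexification V -> A})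
    (cliffA : is_clifford (cform ip) iota)
    (W : set (complexification V)) (subW : GRing.submod_closed (mem W)) :
  supercommutant cliffA (clifford_subalg iota W) =
  clifford_subalg iota (orthogonal_space ip W).
Proof. by apply: supercommutant_clifford; rewrite pnatr_eq0. Qed.
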